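(* For free modules $V_1$ and $V_2$ of infinite ranks over arbitrary rings $R_1$ and $R_2$, respectively, elementary equivalence of the lattices of submodules $P(V_1)$ and $P(V_2)$ implies elementary equivalence of the endomorphism rings $\mathrm{End}_{R_1}(V_1)$ and $\mathrm{End}_{R_2}(V_2)$.
   Context: Rings are associative with unit; modules are left modules. For a module $V$, $P(V)$ (the projective space, or lattice of submodules, of $V$) is the structure whose elements are all submodules of $V$, with the single binary relation $M\subset N$ (''$M$ is a submodule of $N$''). Elementary equivalence of $P(V_1)$ and $P(V_2)$ is with respect to the first order language with this relation; elementary equivalence of rings is with respect to the first order language of rings. *)

(* Defs.v *)
From HB Require Import structures.
From mathcomp Require Import all_boot all_order all_algebra.
From mathcomp Require Import boolp classical_sets functions cardinality.

Set Implicit Arguments.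
Unset Strict Implicit.
Unset Printing Implicit Defensive.

Import GRing.Theory.
Local Open Scope ring_scope.

(* A first-order language is presented by its atomic formulas (equalities
   included), each with the list of variables, named by nat, occurring in it. *)
Record language := Language {
  atom : Type;
  atom_vars : atom -> seq nat }.

Inductive formula (L : language) : Type :=
| Atom of atom L
| Falsum
| Not of formula L
| And of formula L & formula L
| Or of formula L & formula L
| Imp of formula L & formula L
| Forall of nat & formula L
| Exists of nat & formula L.

Fixpoint free_vars (L : language) (f : formula L) : seq nat :=
  match f with
  | Atom a => atom_vars a
  | Falsum => [::]
  | Not g => free_vars g
  | And g h | Or g h | Imp g h => free_vars g ++ free_vars h
  | Forall n g | Exists n g => [seq m <- free_vars g | m != n]
  end.

Definition sentence (L : language) (f : formula L) : Prop :=
  free_vars f = [::].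

Record structure (L : language) := Structure {
  universe : Type;
  atom_holds : (nat -> universe) -> atom L -> Prop }.

Fixpoint holds (L : language) (M : structure L) (e : nat -> universe M)
    (f : formula L) : Prop :=
  match f with
  | Atom a => atom_holds e a
  | Falsum => False
  | Not g => ~ holds e g
  | And g h => holds e g /\ holds e h
  | Or g h => holds e g \/ holds e h
  | Imp g h => holds e g -> holds e h
  | Forall n g => forall x : universe M, holds [eta e with n |-> x] g
  | Exists n g => exists x : universe M, holds [eta e with n |-> x] g
  end.

(* For a sentence the choice of the valuation is immaterial. *)
Definition models (L : language) (M : structure L) (f : formula L) : Prop :=
  forall e : nat -> universe M, holds e f.

Definition elementarily_equivalent (L : language) (M N : structure L) : Prop :=
  forall f : formula L, sentence f -> (models M f <-> models N f).

Inductive inclusion_atom :=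
| EqVar of nat & nat
| Included of nat & nat.

Definition inclusion_language : language :=
  Language (fun a : inclusion_atom =>
    match a with EqVar i j | Included i j => [:: i; j] end).

Inductive ring_term :=
| Var of nat
| Zero
| One
| Opp of ring_term
| Add of ring_term & ring_term
| Mul of ring_term & ring_term.

Fixpoint ring_term_vars (t : ring_term) : seq nat :=
  match t with
  | Var n => [:: n]
  | Zero | One => [::]
  | Opp u => ring_term_vars u
  | Add u v | Mul u v => ring_term_vars u ++ ring_term_vars v
  end.

Inductive ring_atom := EqTerm of ring_term & ring_term.

Definition ring_language : language :=
  Language (fun a : ring_atom =>
    let: EqTerm t u := a in ring_term_vars t ++ ring_term_vars u).

Fixpoint ring_eval (A : pzRingType) (e : nat -> A) (t : ring_term) : A :=
  match t with
  | Var n => e n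
  | Zero => 0
  | One => 1
  | Opp u => - ring_eval e u
  | Add u v => ring_eval e u + ring_eval e v
  | Mul u v => ring_eval e u * ring_eval e v
  end.

Definition ring_structure (A : pzRingType) : structure ring_language :=
  @Structure ring_language A (fun (e : nat -> A) (a : ring_atom) =>
    let: EqTerm t u := a in ring_eval e t = ring_eval e u).

(* Prop-valued counterpart of GRing.submod_closed, which is restricted to
   boolean predicates. *)
Record submodule (R : pzRingType) (V : lmodType R) := Submodule {
  submodule_set :> set V;
  submodule0 : submodule_set 0;
  submoduleP : forall (a : R) (u v : V),
    submodule_set u -> submodule_set v -> submodule_set (a *: u + v) }.

Lemma submodule_eq (R : pzRingType) (V : lmodType R) (M N : submodule V) :
  (M : set V) = N -> M = N.
Proof.
case: M N => [A A0 AP] [B B0 BP] /= eAB; subst B.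
by rewrite (Prop_irrelevance A0 B0) (Prop_irrelevance AP BP).
Qed.

Definition submodule_lattice (R : pzRingType) (V : lmodType R) :
    structure inclusion_language :=
  @Structure inclusion_language (submodule V)
    (fun (e : nat -> submodule V) (a : inclusion_atom) =>
      match a with
      | EqVar i j => e i = e j
      | Included i j => (e i `<=` e j)%classic
      end).

Definition lin_independent (R : pzRingType) (V : lmodType R) (I : choiceType)
    (b : I -> V) : Prop :=
  forall (s : seq I) (a : I -> R), uniq s ->
    \sum_(i <- s) a i *: b i = 0 -> forall i, i \in s -> a i = 0.

Definition spanning (R : pzRingType) (V : lmodType R) (I : choiceType)
    (b : I -> V) : Prop :=
  forall v : V, exists (s : seq I) (a : I -> R), v = \sum_(i <- s) a i *: b i.

Definition is_basis (R : pzRingType) (V : lmodType R) (I : choiceType)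
    (b : I -> V) : Prop :=
  lin_independent b /\ spanning b.

Definition free_of_infinite_rank (R : pzRingType) (V : lmodType R) : Prop :=
  exists (I : choiceType) (b : I -> V), infinite_set [set: I] /\ is_basis b.

Definition endo (R : pzRingType) (V : lmodType R) : Type := {linear V -> V}.

Section EndomorphismRing.
Variables (R : pzRingType) (V : lmodType R).
Implicit Types f g h : endo V.

HB.instance Definition _ := gen_eqMixin (endo V).
HB.instance Definition _ := gen_choiceMixin (endo V).

Lemma endo_eq f g : (forall v : V, f v = g v) -> f = g.
Proof.
case: f g => [f [[cf] [df]]] [g [[cg] [dg]]] /= /funext efg; subst g.
by rewrite (Prop_irrelevance cf cg) (Prop_irrelevance df dg).
Qed.

Definition endo_zero : endo V := \0.
Definition endo_opp f : endo V := \- f.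
Definition endo_add f g : endo V := f \+ g.
Definition endo_one : endo V := idfun.
Definition endo_mul f g : endo V := f \o g.

Fact endo_addA : associative endo_add.
Proof. by move=> f g h; apply: endo_eq => v /=; rewrite addrA. Qed.
Fact endo_addC : commutative endo_add.
Proof. by move=> f g; apply: endo_eq => v /=; rewrite addrC. Qed.
Fact endo_add0 : left_id endo_zero endo_add.
Proof. by move=> f; apply: endo_eq => v /=; rewrite add0r. Qed.
Fact endo_addN : left_inverse endo_zero endo_opp endo_add.
Proof. by move=> f; apply: endo_eq => v /=; rewrite addNr. Qed.

HB.instance Definition _ := GRing.isZmodule.Build (endo V)
  endo_addA endo_addC endo_add0 endo_addN.

Fact endo_mulA : associative endo_mul.
Proof. by move=> f g h; apply: endo_eq. Qed.
Fact endo_mul1 : left_id endo_one endo_mul.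
Proof. by move=> f; apply: endo_eq. Qed.
Fact endo_mulr1 : right_id endo_one endo_mul.
Proof. by move=> f; apply: endo_eq. Qed.
Fact endo_mulDl : left_distributive endo_mul +%R.
Proof. by move=> f g h; apply: endo_eq. Qed.
Fact endo_mulDr : right_distributive endo_mul +%R.
Proof. by move=> f g h; apply: endo_eq => v /=; rewrite raddfD. Qed.

HB.instance Definition _ := GRing.Zmodule_isPzRing.Build (endo V)
  endo_mulA endo_mul1 endo_mulr1 endo_mulDl endo_mulDr.

End EndomorphismRing.

(* Main.v *)
Require Import Defs.
From HB Require Import structures.
From mathcomp Require Import all_boot all_algebra.
From mathcomp Require Import boolp classical_sets functions cardinality.
From mathcomp Require Import zify.

(* The ring End(V) is interpreted in P(V) with parameters. An infinite basis
   splits into two halves, so V ~ V + V ~ V + V + V, and V is the direct sum of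
   A0 = s0(V), A1 = s1(V), A2 = s2(V) with s0, s1, s2 injective. An
   endomorphism f is coded by the submodule {s0 v - s1 (f v)}, that is, by a
   complement of A1 in A0 + A1; addition and multiplication are read off sums
   of such graphs, von Staudt style, using the graphs E01 and E12 of the
   identity. A first-order condition on the parameters has to force A0 ~ V, not
   only A0 ~ A1 ~ A2: this is achieved by one more perspectivity
   A0 ~ A1 + A2, since then V = A0 + (A1 + A2) ~ A0 + A0 ~ A1 + A2 ~ A0. Hence
   every admissible choice of parameters interprets the same ring End(V). *)

Set Implicit Arguments.
Unset Strict Implicit.
Unset Printing Implicit Defensive.

Import GRing.Theory.
Local Open Scope ring_scope.

(** * Splitting an infinite index set *)

(** By Zorn there is a maximal family of injective sequences with disjoint ranges. It misses only
    finitely many elements, since an infinite rest would contain one more sequence; this rest is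
    prepended to one of the sequences. *)
Lemma infinite_disjoint_sequences (I : choiceType) :
  infinite_set [set: I] ->
  exists (S : Type) (s : S -> nat -> I),
    (forall i, exists a n, i = s a n) /\
    (forall a b m n, s a m = s b n -> a = b /\ m = n).
Proof.
move=> Iinf.
have [S [Sinj Sdisj Smax]] := ex_maximal_disjoint_subcollection
  (fun s : nat -> I => range s) [set s | injective s]%classic.
pose U : set I := (\bigcup_(s in S) range s)%classic.
have Ufin : finite_set (~` U)%classic.
  apply: contrapT => /infiniteP/card_leP[/= f].
  pose g := f \o to_setT; pose s n : I := val (g n).
  have sinj : injective s.
    move=> m n /val_inj gmn.
    have : to_setT m = to_setT n by apply: ('inj_f); rewrite ?inE.
    by move=> /(congr1 val).
  have sU n : ~ U (s n) by have := set_valP (g n).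
  have Ss : ~ S s by move=> Ss; apply: (sU 0%N); exists s => //; exists 0%N.
  apply: (Smax (S `|` [set s])%classic).
  - by split; [move=> t; left|move=> /(_ s) sub; apply: Ss; apply: sub; right].
  - by move=> t [/Sinj//|->].
  - move=> t u [St|->] [Su|->] //.
    + exact: Sdisj.
    + move=> [_ [[m _ <-] [n _ /esym]]] e; case: (sU n).
      by exists t => //; exists m.
    + move=> [_ [[m _ <-] [n _ /esym]]] e; case: (sU m).
      by exists u => //; exists n.
have [s0 Ss0] : exists s0, S s0.
  apply: contrapT => S0; apply: Iinf; apply: sub_finite_set Ufin.
  move=> i _ [s Ss _].
  by apply: S0; exists s.
have [l0 /seteqP[Ul lU]] := (finite_seqP _).1 Ufin.
pose l := undup l0.
have lP i : (i \in l) <-> ~ U i.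
  by rewrite mem_undup; split=> [/lU//|/Ul].
(* Only [s0] is shifted, by the length of the list [l] of missed elements; the other sequences keep
   their numbering. *)
pose k (t : nat -> I) := if pselect (t = s0) then size l else 0%N.
have ks0 : k s0 = size l by rewrite /k; case: pselect.
pose s (a : {t | S t}) n : I :=
  if (n < k (sval a))%N then nth (s0 0%N) l n else sval a (n - k (sval a))%N.
have nth_l n (a : {t | S t}) : (n < k (sval a))%N ->
    nth (s0 0%N) l n \in l /\ sval a = s0.
  by rewrite /k; case: pselect => // e nl; split=> //; exact: mem_nth.
have Us n (a : {t | S t}) : U (sval a n).
  by exists (sval a); [exact: svalP|exists n].
exists {t | S t}, s; split=> [i|a b m n].
  have [/lP il|/contrapT[t St [n _ <-]]] := pselect (~ U i).
    exists (exist _ s0 Ss0), (index i l).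
    by rewrite /s ks0 index_mem il nth_index.
  exists (exist _ t St), (n + k t)%N.
  by rewrite /s /= ltnNge leq_addl addnK.
rewrite /s; case: ltnP => [mk|km]; case: ltnP => [nk|kn].
- have [ml ea] := nth_l _ _ mk; have [nl eb] := nth_l _ _ nk.
  have eab : a = b.
    by apply: eq_sig_hprop => [x|]; [exact: Prop_irrelevance|rewrite ea eb].
  subst b; move=> /eqP; rewrite nth_uniq ?undup_uniq //; first by move/eqP.
    by move: mk; rewrite /k; case: pselect.
  by move: nk; rewrite /k; case: pselect.
- by have [/lP ml _] := nth_l _ _ mk => e; case: ml; rewrite e.
- by have [/lP nl _] := nth_l _ _ nk => e; case: nl; rewrite -e.
- move=> e; have eab : sval a = sval b.
    apply: Sdisj; [exact: svalP|exact: svalP|].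
    exists (sval a (m - k (sval a))%N); split; first by eexists.
    by rewrite e; eexists.
  have {eab} eab : a = b.
    by apply: eq_sig_hprop => [x|//]; exact: Prop_irrelevance.
  subst b; split=> //; move/(Sinj _ (svalP a)): e => e.
  by rewrite -(subnK km) e subnK.
Qed.

Lemma infinite_set_doubling (I : choiceType) :
  infinite_set [set: I] ->
  exists (p : bool -> I -> I) (q : I -> bool * I),
    (forall c i, q (p c i) = (c, i)) /\ (forall i, p (q i).1 (q i).2 = i).
Proof.
move=> /infinite_disjoint_sequences[S [s [scover sinj]]].
have /choice[g gE] i : exists an : S * nat, i = s an.1 an.2.
  by have [a [n ->]] := scover i; exists (a, n).
have gs a n : g (s a n) = (a, n).
  by have := sinj _ _ _ _ (gE (s a n)); case: (g _) => /= b m [-> ->].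
(* The two copies of the element at position n of a sequence sit at positions 2n and 2n + 1, and
   parity tells them apart. *)
exists (fun c i => s (g i).1 (c + (g i).2.*2)%N).
exists (fun i => (odd (g i).2, s (g i).1 (g i).2./2)).
split=> [c i|i]; rewrite !gs /=.
  by rewrite oddD odd_double oddb addbF half_bit_double -gE.
by rewrite odd_double_half -gE.
Qed.

(** * Linear maps, bases and V ~ V + V *)

(** Two values of one vector differ by a value of 0, so triviality over 0 makes the relation
    single-valued. Linearity is then inherited from the relation. *)
Lemma linear_of_relation (R : pzRingType) (V W : lmodType R)
    (F : V -> W -> Prop) :
  (forall a u v x y, F u x -> F v y -> F (a *: u + v) (a *: x + y)) ->
  (forall v, exists w, F v w) -> (forall w, F 0 w -> w = 0) ->
  exists f : {linear V -> W}, forall v w, F v w <-> w = f v.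
Proof.
move=> Flin Ftot F0; have [f fF] := choice Ftot.
have Funiq v w w' : F v w -> F v w' -> w = w'.
  move=> Fw Fw'; apply/esym/eqP; rewrite -subr_eq0 addrC; apply/eqP.
  by apply: F0; have := Flin (-1) _ _ _ _ Fw Fw'; rewrite !scaleN1r addNr.
have flin : linear f.
  by move=> a u v; apply: Funiq (fF _) _; apply: Flin.
pose g : {linear V -> W} := HB.pack f (GRing.isLinear.Build R V W *:%R f flin).
by exists g => v w; split=> [Fvw|->]; [exact: Funiq Fvw (fF v)|exact: fF].
Qed.

Section Basis.
Variables (R : pzRingType) (V : lmodType R) (I : choiceType) (b : I -> V).
Hypothesis bP : is_basis b.

(** The relation pairs the values of one formal combination, a list of coefficients and indices, on
    [b] and on [c]. *)
Lemma basis_extension (W : lmodType R) (c : I -> W) :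
  exists f : {linear V -> W}, forall i, f (b i) = c i.
Proof.
have [bfree bspan] := bP.
pose F v w := exists l : seq (R * I),
  v = \sum_(p <- l) p.1 *: b p.2 /\ w = \sum_(p <- l) p.1 *: c p.2.
have [||w|f fF] := @linear_of_relation R V W F.
- move=> a _ _ _ _ [l [-> ->]] [l' [-> ->]].
  exists ([seq (a * p.1, p.2) | p <- l] ++ l').
  rewrite !big_cat !big_map /= !scaler_sumr.
  by split; congr (_ + _); apply: eq_bigr => p _; rewrite scalerA.
- move=> v; have [s [a ->]] := bspan v.
  exists (\sum_(i <- s) a i *: c i), [seq (a i, i) | i <- s].
  by rewrite !big_map.
- move=> [l [l0 ->]].
  (* Indices may repeat in [l]; [a i] is the total coefficient at [i], so that independence, stated
     for duplicate-free lists, applies. *)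
  pose s := undup (map snd l); pose a i := \sum_(p <- l | p.2 == i) p.1.
  have collect (U : lmodType R) (d : I -> U) :
      \sum_(p <- l) p.1 *: d p.2 = \sum_(i <- s) a i *: d i.
    transitivity (\sum_(p <- l) \sum_(i <- s | p.2 == i) p.1 *: d i).
      rewrite big_seq [RHS]big_seq; apply: eq_bigr => p pl.
      rewrite (big_rem p.2) /=; last by rewrite mem_undup map_f.
      rewrite eqxx big1_seq ?addr0 // => i /andP[/eqP <-].
      by rewrite mem_rem_uniq ?undup_uniq // inE eqxx.
    rewrite (exchange_big_dep predT) //=; apply: eq_bigr => i _.
    by rewrite scaler_suml.
  rewrite collect big_seq big1 // => i si.
  by rewrite (bfree s a (undup_uniq _)) ?scale0r // -collect -l0.
exists f => i; apply/esym/fF; exists [:: (1, i)].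
by rewrite !big_seq1 !scale1r.
Qed.

Lemma linear_basis_eq (W : lmodType R) (f g : {linear V -> W}) :
  (forall i, f (b i) = g (b i)) -> f =1 g.
Proof.
move=> fg v; have [s [a ->]] := bP.2 v; rewrite !linear_sum.
by apply: eq_bigr => i _; rewrite !linearZ /= fg.
Qed.

End Basis.

(** [r] and [r'] map V onto the spans of the two halves of the basis; [u] and [u'] in the proof are
    the matching coordinate maps. *)
Lemma free_doubling (R : pzRingType) (V : lmodType R) :
  free_of_infinite_rank V ->
  exists r r' : endo V,
    (forall v, exists x y, v = r x + r' y) /\
    (forall x y, r x + r' y = 0 -> x = 0 /\ y = 0).
Proof.
move=> [I [b [Iinf bP]]].
have [p [q [qp pq]]] := infinite_set_doubling Iinf.
have ext := basis_extension bP.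
have [r rb] := ext V (fun i => b (p false i)).
have [r' rb'] := ext V (fun i => b (p true i)).
have [u ub] := ext V (fun i => if (q i).1 then 0 else b (q i).2).
have [u' ub'] := ext V (fun i => if (q i).1 then b (q i).2 else 0).
exists r, r'; split.
- move=> v; exists (u v), (u' v).
  move: v; apply: (linear_basis_eq bP (f := idfun)
    (g := ((r \o u : endo V) \+ (r' \o u' : endo V) : endo V))) => i /=.
  rewrite ub ub' -{1}(pq i).
  by case: (q i) => -[] j /=; rewrite linear0 ?add0r ?addr0 ?rb ?rb'.
- move=> x y rxy.
  have ur z : u (r z) = z.
    move: z; apply: (linear_basis_eq bP (f := u \o r) (g := idfun)) => i /=.
    by rewrite rb ub qp.
  have ur' z : u (r' z) = 0.
    move: z; apply: (linear_basis_eq bP (f := u \o r') (g := \0)) => i /=.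
    by rewrite rb' ub qp.
  have u'r z : u' (r z) = 0.
    move: z; apply: (linear_basis_eq bP (f := u' \o r) (g := \0)) => i /=.
    by rewrite rb ub' qp.
  have u'r' z : u' (r' z) = z.
    move: z; apply: (linear_basis_eq bP (f := u' \o r') (g := idfun)) => i /=.
    by rewrite rb' ub' qp.
  split.
    by have := congr1 u rxy; rewrite linearD linear0 (ur x) (ur' y) addr0.
  by have := congr1 u' rxy; rewrite linearD linear0 (u'r x) (u'r' y) add0r.
Qed.

Local Notation "v ∈ X" := (submodule_set X v) (at level 70).

(** * Lattice conditions and graphs of endomorphisms *)

Section Submodules.
Variables (R : pzRingType) (V : lmodType R).
Implicit Types (X Y A B W : submodule V) (s t f : endo V).

Definition meets_trivially X Y := forall v, v ∈ X -> v ∈ Y -> v = 0.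

Definition below_sum W X Y :=
  forall v, v ∈ W -> exists x y, [/\ x ∈ X, y ∈ Y & v = x + y].

Lemma submoduleD X u v : u ∈ X -> v ∈ X -> u + v ∈ X.
Proof. by move=> Xu Xv; rewrite -[u]scale1r; exact: submoduleP. Qed.

Lemma submoduleN X v : v ∈ X -> - v ∈ X.
Proof.
move=> Xv; rewrite -scaleN1r -[_ *: _]addr0.
exact: submoduleP (submodule0 X).
Qed.

Lemma lin_combB (a : R) (u v x y : V) :
  (a *: u + v) - (a *: x + y) = a *: (u - x) + (v - y).
Proof. by rewrite opprD addrACA scalerBr. Qed.

Lemma submodule_ext X Y : (forall v, v ∈ X <-> v ∈ Y) -> X = Y.
Proof. by move=> XY; apply: submodule_eq; apply/seteqP; split=> v /XY. Qed.

(** In the lattice, 0 is recognised as the least element; the forward direction takes the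
    intersection as [W]. *)
Lemma meets_triviallyP X Y :
  (forall W, (W `<=` X)%classic /\ (W `<=` Y)%classic ->
     forall U : submodule V, (W `<=` U)%classic) <-> meets_trivially X Y.
Proof.
split=> [meet v Xv Yv|meet W [WX WY] U v Wv]; last first.
  by rewrite (meet v (WX v Wv) (WY v Wv)); exact: submodule0.
have I0 : 0 ∈ X /\ 0 ∈ Y by split; exact: submodule0.
have IP a u w : u ∈ X /\ u ∈ Y -> w ∈ X /\ w ∈ Y ->
    a *: u + w ∈ X /\ a *: u + w ∈ Y.
  by move=> [Xu Yu] [Xw Yw]; split; exact: submoduleP.
have ZP (a : R) (u w : V) : u = 0 -> w = 0 -> a *: u + w = 0.
  by move=> -> ->; rewrite scaler0 addr0.
pose I := @Submodule R V [set v | v ∈ X /\ v ∈ Y]%classic I0 IP.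
pose Z := @Submodule R V [set v | v = 0]%classic erefl ZP.
by apply: (meet I _ Z v) => //; split=> u [].
Qed.

(** X + Y is the least upper bound of [X] and [Y]; the forward direction takes it as [U]. *)
Lemma below_sumP W X Y :
  (forall U : submodule V, (X `<=` U)%classic /\ (Y `<=` U)%classic ->
     (W `<=` U)%classic) <-> below_sum W X Y.
Proof.
split=> [below v Wv|below U [XU YU] v /below[x [y [Xx Yy ->]]]]; last first.
  by apply: submoduleD; [exact: XU|exact: YU].
pose S : set V := [set v | exists x y, [/\ x ∈ X, y ∈ Y & v = x + y]]%classic.
have S0 : S 0 by exists 0, 0; rewrite addr0; split=> //; exact: submodule0.
have SP (a : R) (u w : V) : S u -> S w -> S (a *: u + w).
  move=> [x [y [Xx Yy ->]]] [x' [y' [Xx' Yy' ->]]].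
  exists (a *: x + x'), (a *: y + y').
  by rewrite scalerDr addrACA; split=> //; exact: submoduleP.
apply: (below (Submodule S0 SP)) => //; split=> u Uu.
  by exists u, 0; rewrite addr0; split=> //; exact: submodule0.
by exists 0, u; rewrite add0r; split=> //; exact: submodule0.
Qed.

Fact endo_image0 f : exists x, 0 = f x.
Proof. by exists 0; rewrite linear0. Qed.

Fact endo_imageP f (a : R) (u v : V) :
  (exists x, u = f x) -> (exists x, v = f x) -> exists x, a *: u + v = f x.
Proof. by move=> [x ->] [y ->]; exists (a *: x + y); rewrite linearP. Qed.

Definition endo_image f : submodule V :=
  @Submodule R V [set v | exists x, v = f x]%classic
    (endo_image0 f) (@endo_imageP f).

Lemma mem_endo_image f x : f x ∈ endo_image f. Proof. by exists x. Qed.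

Definition independent s t := forall x y, s x + t y = 0 -> x = 0 /\ y = 0.

(** For independent [A] and [B]: [X] is a complement of [B] in A + B, that is, the graph of a linear
    map from [A] to [B]. *)
Definition is_graph X A B :=
  [/\ meets_trivially X B, below_sum X A B & below_sum A X B].

(** The value [f x] is the unique y with s x - t y in [X]: it exists because A lies in X + B, and is
    unique because [X] meets B trivially. *)
Lemma is_graphP s t X : independent s t ->
  is_graph X (endo_image s) (endo_image t) <->
  exists f : endo V, X = endo_image (s - t * f).
Proof.
move=> st; split=> [[XB XAB AXB]|[f ->]]; last first.
  split.
  - move=> _ [x ->] [y e]; have /st[-> _] : s x + t (- f x - y) = 0.
      by rewrite linearB linearN addrA; apply/eqP; rewrite subr_eq0; apply/eqP.
    by rewrite linear0.
  - move=> _ [x ->]; exists (s x), (- t (f x)).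
    split=> //; first exact: mem_endo_image.
    by rewrite -linearN; exact: mem_endo_image.
  - move=> _ [x ->]; exists (s x - t (f x)), (t (f x)); split=> //.
    + by exists x.
    + exact: mem_endo_image.
    + by rewrite subrK.
have [||y Xy|f fF] := @linear_of_relation R V V (fun x y => s x - t y ∈ X).
- move=> a u v x y Xux Xvy; rewrite (linearP s) (linearP t) lin_combB.
  exact: submoduleP.
- move=> x; have [z [_ [Xz [y ->] sx]]] := AXB _ (mem_endo_image s x).
  by exists y; rewrite sx addrK.
- have ty0 : t y = 0.
    apply: XB; last exact: mem_endo_image.
    by move: Xy; rewrite linear0 sub0r => /submoduleN; rewrite opprK.
  by have [|//] := st 0 y; rewrite linear0 add0r.
exists f; apply: submodule_ext => v; split=> [Xv|[x ->]]; last first.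
  exact/fF.
have [_ [_ [[x ->] [y ->] ev]]] := XAB _ Xv; subst v.
by exists x; rewrite /= -(fF x (- y)).1 ?linearN ?opprK.
Qed.

Lemma graph_inj s t f g : independent s t ->
  endo_image (s - t * f) = endo_image (s - t * g) -> f = g.
Proof.
move=> st eq_fg; apply: endo_eq => x.
have : s x - t (f x) ∈ endo_image (s - t * g) by rewrite -eq_fg; exists x.
move=> [y e]; have /st[/eqP xy /eqP gf] : s (x - y) + t (g y - f x) = 0.
  rewrite !linearB [t (g y) - _]addrC addrACA e [- s y + _]addrC.
  rewrite -[t (g y) - _]opprB.
  exact: subrr.
by move: xy gf; rewrite !subr_eq0 => /eqP <- /eqP.
Qed.

(** A common complement of [A] and [B] in A + B, hence the graph of an isomorphism between them. *)
Definition perspectivity X A B := is_graph X A B /\ is_graph X B A.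

Lemma perspectivity_image s t :
  independent s t ->
  perspectivity (endo_image (s - t)) (endo_image s) (endo_image t).
Proof.
move=> st; split; first by apply/(is_graphP _ st); exists 1; rewrite mulr1.
have ts : independent t s by move=> x y; rewrite addrC => /st[-> ->].
(* Exchanging [s] and [t] changes the sign of s - t, hence not its image. *)
apply/(is_graphP _ ts); exists 1; rewrite mulr1; apply: submodule_ext => v.
by split=> -[x ->]; exists (- x); rewrite linearN /= opprB.
Qed.

Lemma perspective_endo X A B s : perspectivity X A B -> A = endo_image s ->
  (forall x, s x = 0 -> x = 0) ->
  exists t : endo V,
    [/\ forall x, t x = 0 -> x = 0, B = endo_image t & X = endo_image (s - t)].
Proof.
move=> [[XB XAB AXB] [XA XBA BXA]] eA s0; subst A.
have [||y [By Xy]|t tF] :=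
    @linear_of_relation R V V (fun x y => y ∈ B /\ s x - y ∈ X).
- move=> a u v x y [Bx Xux] [By Xvy]; rewrite (linearP s) lin_combB.
  by split; exact: submoduleP.
- move=> x; have [z [y [Xz By sx]]] := AXB _ (mem_endo_image s x).
  by exists y; rewrite sx addrK.
- apply: XB => //.
  by move: Xy; rewrite linear0 sub0r => /submoduleN; rewrite opprK.
have tB x : t x ∈ B by have [] := (tF x _).2 erefl.
have tX x : s x - t x ∈ X by have [] := (tF x _).2 erefl.
exists t; split.
- move=> x tx0; apply/s0/XA; last exact: mem_endo_image.
  by have := tX x; rewrite tx0 subr0.
- apply: submodule_ext => v; split=> [Bv|[x -> //]].
  have [y [_ [Xy [x ->] ev]]] := BXA _ Bv.
  exists x; apply/tF; split=> //.
  by rewrite ev opprD addrCA subrr addr0; exact: submoduleN.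
- apply: submodule_ext => v; split=> [Xv|[x ->]]; last exact: tX.
  have [_ [b [[x ->] Bb ev]]] := XAB _ Xv.
  exists x; rewrite ev /= -((tF x (- b)).1 _) ?opprK //.
  by split; [exact: submoduleN|rewrite -ev].
Qed.

End Submodules.

(** * Frames and their construction from lattice data *)

Section Frames.
Variables (R : pzRingType) (V : lmodType R).
Implicit Types (X Y A B W : submodule V).

(** The three maps are the components of an isomorphism from V + V + V onto V. *)
Record is_frame (s0 s1 s2 : endo V) : Prop := IsFrame {
  frame_cover : forall v, exists x y z, v = s0 x + s1 y + s2 z;
  frame_free : forall x y z,
    s0 x + s1 y + s2 z = 0 -> [/\ x = 0, y = 0 & z = 0] }.

(* The isomorphism V -> A0 behind s0 is the chain
   V = A0 + S ~ A0 + A0 ~ A1 + A2 = S ~ A0. *)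
Lemma perspectivities_frame A0 A1 A2 S E01 E12 D :
    meets_trivially A0 S -> (forall W, below_sum W A0 S) ->
    meets_trivially A1 A2 -> (A1 `<=` S)%classic -> (A2 `<=` S)%classic ->
    below_sum S A1 A2 -> perspectivity D A0 S ->
    perspectivity E01 A0 A1 -> perspectivity E12 A1 A2 ->
  exists s0 s1 s2 : endo V, is_frame s0 s1 s2 /\
    [/\ A0 = endo_image s0, A1 = endo_image s1, A2 = endo_image s2,
        E01 = endo_image (s0 - s1) & E12 = endo_image (s1 - s2)].
Proof.
move=> A0S VA0S A12 A1S A2S SA12 pD pE01 pE12.
have [[DS DA0S A0DS] [DA0 DSA0 SDA0]] := pD.
have [[E01A1 _ A0E01] [E01A0 _ A1E01]] := pE01.
have [[E12A2 _ A1E12] [E12A1 _ A2E12]] := pE12.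
have flip X u v : u - v ∈ X -> v - u ∈ X.
  by move=> /submoduleN; rewrite opprB.
have sub0 X v : 0 - v ∈ X -> v ∈ X.
  by rewrite sub0r => /submoduleN; rewrite opprK.
(* Here v = a + (v - a) in A0 + S; [a'] is the partner of v - a in A0 along [D], [b] and [c] are
   those of [a] and [a'] in A1 along [E01], [d] is that of [c] in A2 along [E12], and [x] is that of
   b + d in A0 along [D]. *)
pose F v x := exists a a' b c d,
  [/\ a ∈ A0, v - a ∈ S, a' ∈ A0 & a' - (v - a) ∈ D] /\
  [/\ b ∈ A1, a - b ∈ E01, c ∈ A1, a' - c ∈ E01 & d ∈ A2] /\
  [/\ c - d ∈ E12, x ∈ A0 & x - (b + d) ∈ D].
have [||x|s0 s0F] := @linear_of_relation R V V F.
- move=> k u v x y [a [a' [b [c [d [[h1 h2 h3 h4]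
    [[h5 h6 h7 h8 h9] [h10 h11 h12]]]]]]]].
  move=> [a1 [a1' [b1 [c1 [d1 [[g1 g2 g3 g4]
    [[g5 g6 g7 g8 g9] [g10 g11 g12]]]]]]]].
  exists (k *: a + a1), (k *: a' + a1'), (k *: b + b1), (k *: c + c1).
  exists (k *: d + d1).
  have -> : k *: b + b1 + (k *: d + d1) = k *: (b + d) + (b1 + d1).
    by rewrite addrACA scalerDr.
  by rewrite !lin_combB; do ?split; apply: submoduleP.
- move=> v.
  have [a [s [A0a Ss ev]]] := VA0S (endo_image 1) v (mem_endo_image 1 v).
  have [z [a' [Dz A0a' es]]] := SDA0 _ Ss.
  have [z1 [b [E01z1 A1b ea]]] := A0E01 _ A0a.
  have [z2 [c [E01z2 A1c ea']]] := A0E01 _ A0a'.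
  have [z3 [d [E12z3 A2d ec]]] := A1E12 _ A1c.
  have Sbd : b + d ∈ S by apply: submoduleD; [exact: A1S|exact: A2S].
  have [z4 [x [Dz4 A0x ebd]]] := SDA0 _ Sbd.
  exists x, a, a', b, c, d.
  have -> : v - a = s by rewrite ev addrC addKr.
  split; split=> //; [|split|split=> //]; rewrite //.
  + by apply: flip; rewrite es addrK.
  + by rewrite ea addrK.
  + by rewrite ea' addrK.
  + by rewrite ec addrK.
  + by apply: flip; rewrite ebd addrK.
(* Over v = 0 the links of the chain vanish one after the other. *)
- move=> [a [a' [b [c [d [[h1 h2 h3 h4]
    [[h5 h6 h7 h8 h9] [h10 h11 h12]]]]]]]].
  have a0 : a = 0 by apply: A0S => //; exact: sub0.
  have a'0 : a' = 0 by apply: DA0 => //; move: h4; rewrite a0 !subr0.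
  have b0 : b = 0 by apply: E01A1 => //; apply: sub0; rewrite -a0.
  have c0 : c = 0 by apply: E01A1 => //; apply: sub0; rewrite -a'0.
  have d0 : d = 0 by apply: E12A2 => //; apply: sub0; rewrite -c0.
  by apply: DA0 => //; move: h12; rewrite b0 d0 addr0 subr0.
have s0_inj v : s0 v = 0 -> v = 0.
  move=> /esym/s0F [a [a' [b [c [d [[h1 h2 h3 h4]
    [[h5 h6 h7 h8 h9] [h10 h11 h12]]]]]]]].
  have bd0 : b + d = 0.
    by apply: DS; [exact: sub0|apply: submoduleD; [exact: A1S|exact: A2S]].
  have b0 : b = 0.
    apply: A12 => //; move/eqP: bd0; rewrite addr_eq0 => /eqP ->.
    exact: submoduleN.
  have d0 : d = 0 by move: bd0; rewrite b0 add0r.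
  have c0 : c = 0 by apply: E12A1 => //; move: h10; rewrite d0 subr0.
  have a'0 : a' = 0 by apply: E01A0 => //; move: h8; rewrite c0 subr0.
  have a0 : a = 0 by apply: E01A0 => //; move: h6; rewrite b0 subr0.
  rewrite a0 subr0 in h2 h4; apply: DS => //.
  by apply: sub0; rewrite -a'0.
have eA0 : A0 = endo_image s0.
  apply: submodule_ext => x; split=> [A0x|[v ->]]; last first.
    by have [a [a' [b [c [d [_ [_ []]]]]]]] := (s0F v _).2 erefl.
  (* A preimage comes from the inverse chain: [x] to [s] = b + d in S, [d] to [c] in A1, then [b]
     and [c] to [a] and [a'] in A0, and [a'] to [s'] in S. *)
  have [z [s [Dz Ss ex]]] := A0DS _ A0x.
  have [b [d [A1b A2d es]]] := SA12 _ Ss.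
  have [z1 [c [E12z1 A1c ed]]] := A2E12 _ A2d.
  have [z2 [a' [E01z2 A0a' ec]]] := A1E01 _ A1c.
  have [z3 [a [E01z3 A0a eb]]] := A1E01 _ A1b.
  have [z4 [s' [Dz4 Ss' ea']]] := A0DS _ A0a'.
  exists (a + s'); apply/s0F; exists a, a', b, c, d.
  have -> : a + s' - a = s' by rewrite addrC addKr.
  split; split=> //; [|split|split=> //]; rewrite //.
  + by rewrite ea' addrK.
  + by apply: flip; rewrite eb addrK.
  + by apply: flip; rewrite ec addrK.
  + by apply: flip; rewrite ed addrK.
  + by rewrite -es ex addrK.
have [s1 [s1_inj eA1 eE01]] := perspective_endo pE01 eA0 s0_inj.
have [s2 [s2_inj eA2 eE12]] := perspective_endo pE12 eA1 s1_inj.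
exists s0, s1, s2; split; split=> //.
- move=> v.
  have [a [s [A0a Ss ev]]] := VA0S (endo_image 1) v (mem_endo_image 1 v).
  have [b [d [A1b A2d es]]] := SA12 _ Ss.
  rewrite eA0 in A0a; rewrite eA1 in A1b; rewrite eA2 in A2d.
  move: A0a A1b A2d => [x ex] [y ey] [z ez].
  by exists x, y, z; rewrite -ex -ey -ez -addrA -es.
- move=> x y z /eqP; rewrite -addrA addr_eq0 => /eqP e.
  have Sbd : s1 y + s2 z ∈ S.
    by apply: submoduleD; [apply: A1S; rewrite eA1|apply: A2S; rewrite eA2];
      exact: mem_endo_image.
  have sx0 : s0 x = 0.
    apply: A0S; first by rewrite eA0; exact: mem_endo_image.
    by rewrite e; exact: submoduleN.
  have sy0 : s1 y = 0.
    apply: A12; first by rewrite eA1; exact: mem_endo_image.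
    move: e; rewrite sx0 => /esym/eqP; rewrite oppr_eq0 addr_eq0 => /eqP ->.
    by rewrite eA2; apply: submoduleN; exact: mem_endo_image.
  have sz0 : s2 z = 0.
    by move: e; rewrite sx0 sy0 add0r => /esym/eqP; rewrite oppr_eq0 => /eqP.
  by split; [exact: s0_inj|exact: s1_inj|exact: s2_inj].
Qed.

End Frames.

(** This is the coordinate along [s0]; freeness of the frame makes it single-valued. *)
Lemma frame_projection (R : pzRingType) (V : lmodType R) (s0 s1 s2 : endo V) :
  is_frame s0 s1 s2 ->
  exists t : endo V,
    [/\ forall x, t (s0 x) = x, forall x, t (s1 x) = 0 &
        forall x, t (s2 x) = 0].
Proof.
move=> [cover free].
have [||x [y [z /esym /free[]]] //|t tF] := @linear_of_relation R V V
    (fun v x => exists y z, v = s0 x + s1 y + s2 z).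
- move=> a _ _ x x' [y [z ->]] [y' [z' ->]].
  exists (a *: y + y'), (a *: z + z').
  rewrite (linearP s0) (linearP s1) (linearP s2) !scalerDr addrACA.
  by congr (_ + _); rewrite addrACA.
- exact: cover.
exists t; split=> x; apply/esym/tF.
- by exists 0, 0; rewrite !linear0 !addr0.
- by exists x, 0; rewrite !linear0 addr0 add0r.
- by exists 0, x; rewrite !linear0 !add0r.
Qed.

(** * Multiplication and addition of graphs *)

Section FrameArithmetic.
Variables (R : pzRingType) (V : lmodType R) (s0 s1 s2 : endo V).
Hypothesis sP : is_frame s0 s1 s2.
Implicit Types f g h : endo V.

Lemma frame_rot : is_frame s1 s2 s0.
Proof.
have [cover free] := sP; split=> [v|x y z].
  have [x [y [z ->]]] := cover v.
  by exists y, z, x; rewrite [RHS]addrC addrA.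
by rewrite addrC addrA => /free[-> -> ->].
Qed.

Lemma frame_independent : independent s0 s1.
Proof.
move=> x y e; have [|-> -> _ //] := frame_free sP (x := x) (y := y) (z := 0).
by rewrite linear0 addr0.
Qed.

Lemma frame_independent02 : independent s0 s2.
Proof.
move=> x y e; have [|-> _ -> //] := frame_free sP (x := x) (y := 0) (z := y).
by rewrite linear0 addr0.
Qed.

Lemma frame_coordinates : exists t0 t1 t2 : endo V,
  [/\ forall x, t0 (s0 x) = x, forall x, t0 (s1 x) = 0 &
      forall x, t0 (s2 x) = 0] /\
  [/\ forall x, t1 (s1 x) = x, forall x, t1 (s2 x) = 0 &
      forall x, t1 (s0 x) = 0] /\
  [/\ forall x, t2 (s2 x) = x, forall x, t2 (s0 x) = 0 &
      forall x, t2 (s1 x) = 0].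
Proof.
have [t0 t0P] := frame_projection sP.
have [t1 t1P] := frame_projection frame_rot.
have [cover free] := sP.
have rot2 : is_frame s2 s0 s1.
  split=> [v|x y z].
    have [x [y [z ->]]] := cover v.
    by exists z, x, y; rewrite addrC addrA.
  by rewrite -addrA addrC => /free[-> -> ->].
have [t2 t2P] := frame_projection rot2.
by exists t0, t1, t2.
Qed.

(** The middle terms telescope: (s0 - s2 g f) v = (s0 - s1 f) v + (s1 - s2 g)(f v). Conversely, the
    three coordinates of such a sum determine [h v]. *)
Lemma graph_mul f g h :
  below_sum (endo_image (s0 - s2 * h)) (endo_image (s0 - s1 * f))
    (endo_image (s1 - s2 * g))
  <-> h = g * f.
Proof.
split=> [below|-> _ [v ->]]; last first.
  exists ((s0 - s1 * f) v), ((s1 - s2 * g) (f v)).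
  split; [exact: mem_endo_image|exact: mem_endo_image|].
  by rewrite /= addrA subrK.
have [t0 [t1 [t2 [[t00 t01 t02] [[t11 t12 t10] [t22 t20 t21]]]]]] :=
  frame_coordinates.
apply: endo_eq => v.
have [_ [_ [[a ->] [c ->]]]] := below _ (mem_endo_image _ v).
rewrite /= => e.
have := congr1 t0 e; have := congr1 t1 e; have := congr1 t2 e.
rewrite !(linearD t0, linearN t0, linearD t1, linearN t1).
rewrite !(linearD t2, linearN t2).
rewrite !(t00, t01, t02, t11, t12, t10, t22, t20, t21, oppr0, addr0, add0r).
by move=> /oppr_inj -> /eqP + ->; rewrite eq_sym addrC subr_eq0 => /eqP ->.
Qed.

(** The intended [U] is the graph of v -> (f v, g v) from A0 to A1 + A2: modulo A2 it is the graph
    of [f], modulo A1 that of [g], and E12 moves its A2-component into A1, where the two components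
    add up. *)
Lemma graph_add f g h :
  (exists U, below_sum U (endo_image (s0 - s1 * f)) (endo_image s2) /\
     below_sum U (endo_image (s0 - s2 * g)) (endo_image s1) /\
     below_sum (endo_image (s0 - s1 * h)) U (endo_image (s1 - s2)))
  <-> h = f + g.
Proof.
split=> [[U [Uf [Ug below]]]|->]; last first.
  exists (endo_image (s0 - s1 * f - s2 * g)); split; [|split] => _ [v ->].
  - exists ((s0 - s1 * f) v), (s2 (- g v)); split; try exact: mem_endo_image.
    by rewrite linearN.
  - exists ((s0 - s2 * g) v), (s1 (- f v)); split; try exact: mem_endo_image.
    by rewrite linearN /= addrAC.
  (* The argument [- g v] cancels the A2-component and puts [- s1 (g v)] in its place. *)
  - exists ((s0 - s1 * f - s2 * g) v), ((s1 - s2) (- g v)).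
    split; try exact: mem_endo_image.
    rewrite /= (linearN s1) (linearN s2) (linearD s1) opprK opprD !addrA.
    by rewrite [RHS]addrAC subrK.
have [t0 [t1 [t2 [[t00 t01 t02] [[t11 t12 t10] [t22 t20 t21]]]]]] :=
  frame_coordinates.
have tE := (linearD t0, linearN t0, linearD t1, linearN t1,
  (linearD t2, linearN t2)).
have tsE := (t00, t01, t02, t11, t12, t10, t22, t20, t21,
  (oppr0, addr0, add0r)).
apply: endo_eq => v; have [u [_ [Uu [w ->]]]] := below _ (mem_endo_image _ v).
have [_ [_ [[a ->] [b ->] euf]]] := Uf _ Uu.
have [_ [_ [[a' ->] [b' ->] eug]]] := Ug _ Uu.
rewrite /= in euf eug *.
(* The two bounds on [U] fix its elements: the coordinates of [u] in A1 and A2 are -f and -g of its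
   coordinate in A0. *)
have t0u : t0 u = a by rewrite euf !tE !tsE.
have t0u' : t0 u = a' by rewrite eug !tE !tsE.
have t1u : t1 u = - f a by rewrite euf !tE !tsE.
have t2u : t2 u = - g a' by rewrite eug !tE !tsE.
rewrite -t0u in t1u; rewrite -t0u' in t2u => e.
have := congr1 t0 e; have := congr1 t1 e; have := congr1 t2 e.
rewrite !tE !tsE t1u t2u => /esym/eqP; rewrite subr_eq0 => /eqP <-.
by rewrite -opprD => /oppr_inj -> ->.
Qed.

End FrameArithmetic.

(** * First-order formulas of the interpretation *)

Definition incl (x y : nat) : formula inclusion_language :=
  @Atom inclusion_language (Included x y).

Definition same (x y : nat) : formula inclusion_language :=
  @Atom inclusion_language (EqVar x y).

(** The bound variables are numbered above the given ones, so that nothing is captured. *)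
Definition fdisj (x y : nat) : formula inclusion_language :=
  let w := (x + y).+1 in
  Forall w (Imp (And (incl w x) (incl w y)) (Forall w.+1 (incl w w.+1))).

Definition fbelow (z x y : nat) : formula inclusion_language :=
  let w := (x + y + z).+1 in
  Forall w (Imp (And (incl x w) (incl y w)) (incl z w)).

Definition fgraph (z x y : nat) : formula inclusion_language :=
  And (fdisj z y) (And (fbelow z x y) (fbelow x z y)).

Definition fpersp (z x y : nat) : formula inclusion_language :=
  And (fgraph z x y) (fgraph z y x).

(* The variables 0, ..., 6 stand for A0, A1, A2, E01, E12, S and D. *)
Definition fframe : formula inclusion_language :=
  And (fdisj 0 5) (And (Forall 7 (fbelow 7 0 5)) (And (fdisj 1 2)
    (And (incl 1 5) (And (incl 2 5) (And (fbelow 5 1 2)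
      (And (fpersp 6 0 5) (And (fpersp 3 0 1) (fpersp 4 1 2)))))))).

(* An endomorphism f is coded by the graph (s0 - s1 f)(V) from A0 to A1;
   fcode02 and fcode12 move the code to the graph of f from A0 to A2, and then
   from A1 to A2. *)
Definition fcode (x : nat) : formula inclusion_language := fgraph x 0 1.

Definition fcode02 (x y : nat) : formula inclusion_language :=
  And (fgraph y 0 2) (fbelow y x 4).

Definition fcode12 (x y : nat) : formula inclusion_language :=
  And (fgraph y 1 2) (fbelow x 3 y).

(** Bound variables start at [k], to be taken above those in use: [k] holds the graph of [y] from A0
    to A2, and [k.+1] the submodule [U] of [graph_add]. *)
Definition fadd (k x y z : nat) : formula inclusion_language :=
  And (fcode z) (Exists k (And (fcode02 y k) (Exists k.+1
    (And (fbelow k.+1 x 2) (And (fbelow k.+1 k 1) (fbelow z k.+1 4)))))).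

(** In the composite [y] acts first and stays a graph from A0 to A1; [x] is moved to a graph from A1
    to A2, and [z] to one from A0 to A2, as [graph_mul] requires. *)
Definition fmul (k x y z : nat) : formula inclusion_language :=
  And (fcode z) (Exists k (And (fcode02 x k) (Exists k.+1
    (And (fcode12 k k.+1) (Exists k.+2
      (And (fcode02 z k.+2) (fbelow k.+2 y k.+1))))))).

(** The shift reserves 0, ..., 6 for the frame parameters. *)
Definition ring_var (n : nat) : nat := n + 7.

(** The sum of the variables of [t] bounds each of them, so the result exceeds [z], the parameters
    and every [ring_var n] with [n] in [t]. *)
Definition fresh (z : nat) (t : ring_term) : nat :=
  (z + sumn (ring_term_vars t) + 7).+1.

(** A0 is the graph of 0 and E01 that of the identity, so the parameters 0 and 3 name the constants;
    an opposite is a code whose sum with the code of [u] is A0. *)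
Fixpoint fterm (t : ring_term) (z : nat) : formula inclusion_language :=
  let k := fresh z t in
  match t with
  | Var n => same z (ring_var n)
  | Zero => same z 0
  | One => same z 3
  | Opp u => And (fcode z) (Exists k (And (fterm u k) (fadd k.+1 k z 0)))
  | Add u v => Exists k (Exists k.+1
      (And (fterm u k) (And (fterm v k.+1) (fadd k.+2 k k.+1 z))))
  | Mul u v => Exists k (Exists k.+1
      (And (fterm u k) (And (fterm v k.+1) (fmul k.+2 k k.+1 z))))
  end.

Fixpoint translate (f : formula ring_language) : formula inclusion_language :=
  match f with
  | Atom (EqTerm t u) =>
      let k := (fresh 0 t + fresh 0 u)%N in
      Exists k (And (fterm t k) (fterm u k))
  | Falsum => Falsum inclusion_language
  | Not g => Not (translate g)
  | And g h => And (translate g) (translate h)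
  | Or g h => Or (translate g) (translate h)
  | Imp g h => Imp (translate g) (translate h)
  | Forall n g => Forall (ring_var n) (Imp (fcode (ring_var n)) (translate g))
  | Exists n g => Exists (ring_var n) (And (fcode (ring_var n)) (translate g))
  end.

(** * Meaning of the formulas in P(V) *)

Section LatticeSemantics.
Variables (R : pzRingType) (V : lmodType R).
Local Notation P := (submodule_lattice V).
Implicit Types e : nat -> submodule V.

Lemma fdisjP e x y :
  holds (M := P) e (fdisj x y) <-> meets_trivially (e x) (e y).
Proof.
rewrite -meets_triviallyP /= !eqxx.
have -> : (x == (x + y).+1) = false by lia.
have -> : (y == (x + y).+1) = false by lia.
by have -> : ((x + y).+1 == (x + y).+2) = false by lia.
Qed.

Lemma fbelowP e z x y :
  holds (M := P) e (fbelow z x y) <-> below_sum (e z) (e x) (e y).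
Proof.
rewrite -below_sumP /= !eqxx.
have -> : (x == (x + y + z).+1) = false by lia.
have -> : (y == (x + y + z).+1) = false by lia.
by have -> : (z == (x + y + z).+1) = false by lia.
Qed.

Lemma fgraphP e z x y :
  holds (M := P) e (fgraph z x y) <-> is_graph (e z) (e x) (e y).
Proof.
split=> [[/fdisjP ? [/fbelowP ? /fbelowP ?]]|[? ? ?]]; first by split.
by split; [apply/fdisjP|split; apply/fbelowP].
Qed.

Lemma fperspP e z x y :
  holds (M := P) e (fpersp z x y) <-> perspectivity (e z) (e x) (e y).
Proof.
split=> [[/fgraphP ? /fgraphP ?]|[? ?]]; first by split.
by split; apply/fgraphP.
Qed.

Definition frame_valuation (s0 s1 s2 : endo V) e :=
  [/\ e 0 = endo_image s0, e 1 = endo_image s1, e 2 = endo_image s2,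
      e 3 = endo_image (s0 - s1) & e 4 = endo_image (s1 - s2)].

Lemma fframe_sound e : holds (M := P) e fframe ->
  exists s0 s1 s2, is_frame s0 s1 s2 /\ frame_valuation s0 s1 s2 e.
Proof.
move=> [/fdisjP h1 [h2 [/fdisjP h3 [h4 [h5 [/fbelowP h6 [/fperspP h7
  [/fperspP h8 /fperspP h9]]]]]]]].
by apply: perspectivities_frame h7 h8 h9 => // W; have /fbelowP := h2 W.
Qed.

Lemma fframe_satisfiable :
  free_of_infinite_rank V -> exists e, holds (M := P) e fframe.
Proof.
move=> /free_doubling[r [r' [cover indep]]].
(* Doubling twice: A0 = r V and S = r' V, then S splits into A1 = r' r V and A2 = r' r' V. The list
   follows the numbering of the parameters, and the default fills the variables above 6. *)
pose e := nth (endo_image r') [:: endo_image r; endo_image (r' * r);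
  endo_image (r' * r'); endo_image (r - r' * r);
  endo_image (r' * r - r' * r'); endo_image r'; endo_image (r - r')].
have r'_inj y : r' y = 0 -> y = 0.
  by move=> ry; have [|//] := indep 0 y; rewrite linear0 add0r.
have indep1 : independent r (r' * r).
  by move=> x y /indep[-> ry]; have [|//] := indep y 0; rewrite linear0 addr0.
have indep2 : independent (r' * r) (r' * r').
  by move=> x y; rewrite /= -linearD => /r'_inj /indep.
have meet s t :
    independent s t -> meets_trivially (endo_image s) (endo_image t).
  move=> st _ [x ->] [y e']; have [|-> _] := st x (- y); last exact: linear0.
  by rewrite linearN e' subrr.
have sum W : below_sum W (endo_image r) (endo_image r').
  move=> v _; have [x [y ->]] := cover v.
  by exists (r x), (r' y); split=> //; exact: mem_endo_image.
exists e; split; [|split; [|split; [|split; [|split; [|split; [|split]]]]]].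
- by apply/fdisjP; apply: meet.
- by move=> W; apply/fbelowP; exact: sum.
- by apply/fdisjP; apply: meet.
- by move=> _ [x ->]; exact: (mem_endo_image r').
- by move=> _ [x ->]; exact: (mem_endo_image r').
- apply/fbelowP => _ [v ->]; have [x [y ->]] := cover v.
  exists ((r' * r) x), ((r' * r') y).
  by split; try exact: mem_endo_image; rewrite linearD.
- by apply/fperspP; exact: perspectivity_image.
- by split; apply/fperspP; exact: perspectivity_image.
Qed.

Lemma valuation_lt e k X i : (i < k)%N -> [eta e with k |-> X] i = e i.
Proof. by move=> ik; rewrite /= (ltn_eqF ik). Qed.

Section Codes.
Variables (s0 s1 s2 : endo V).
Hypothesis sP : is_frame s0 s1 s2.
Local Notation frame_valuation := (frame_valuation s0 s1 s2).
Local Notation code01 f := (endo_image (s0 - s1 * f)).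
Local Notation code02 f := (endo_image (s0 - s2 * f)).
Local Notation code12 f := (endo_image (s1 - s2 * f)).

Lemma frame_valuation_upd e k X :
  (4 < k)%N -> frame_valuation e -> frame_valuation [eta e with k |-> X].
Proof.
move=> k4 [e0 e1 e2 e3 e4].
by split; rewrite valuation_lt //; apply: leq_trans k4.
Qed.

Lemma code01_inj f g : code01 f = code01 g -> f = g.
Proof. exact: graph_inj (frame_independent sP). Qed.

Lemma code01_0 : code01 0 = endo_image s0.
Proof. by rewrite mulr0 subr0. Qed.

Lemma code01_1 : code01 1 = endo_image (s0 - s1).
Proof. by rewrite mulr1. Qed.

Lemma fcodeP e x :
  frame_valuation e -> holds (M := P) e (fcode x) <-> exists f, e x = code01 f.
Proof.
move=> [e0 e1 _ _ _].
by rewrite fgraphP e0 e1 (is_graphP _ (frame_independent sP)).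
Qed.

Lemma fcode02P e x y f : frame_valuation e -> e x = code01 f ->
  holds (M := P) e (fcode02 x y) <-> e y = code02 f.
Proof.
move=> [e0 e1 e2 e3 e4] ex.
have graphP := is_graphP (e y) (frame_independent02 sP).
(* E12 is the graph of 1, so composing with it moves a graph from A1 to A2 without changing the
   endomorphism. *)
have mulP h := graph_mul sP f 1 h; rewrite mulr1 mul1r in mulP.
split=> [[/fgraphP + /fbelowP]|ey].
  by rewrite e0 e2 e4 ex => /graphP[h ->] /mulP ->.
split; first by apply/fgraphP; rewrite e0 e2; apply/graphP; exists f.
by apply/fbelowP; rewrite ey ex e4; apply/mulP.
Qed.

Lemma fcode12P e x y f : frame_valuation e -> e x = code02 f ->
  holds (M := P) e (fcode12 x y) <-> e y = code12 f.
Proof.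
move=> [e0 e1 e2 e3 e4] ex.
have graphP := is_graphP (e y) (frame_independent (frame_rot sP)).
(* Here the first factor is 1, with code E01. *)
have mulP g := graph_mul sP 1 g f.
split=> [[/fgraphP + /fbelowP]|ey].
  rewrite e1 e2 e3 ex => /graphP[g ->]; rewrite -code01_1 => /mulP ->.
  by rewrite mulr1.
split; first by apply/fgraphP; rewrite e1 e2; apply/graphP; exists f.
by apply/fbelowP; rewrite ey ex e3 -code01_1; apply/mulP; rewrite mulr1.
Qed.

Lemma faddP e k x y z f g : frame_valuation e ->
    (x < k)%N -> (y < k)%N -> (z < k)%N -> (4 < k)%N ->
    e x = code01 f -> e y = code01 g ->
  holds (M := P) e (fadd k x y z) <-> e z = code01 (f + g).
Proof.
move=> eP xk yk zk k4 ex ey.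
have e'P Y := frame_valuation_upd Y k4 eP.
have e'y Y : [eta e with k |-> Y] y = code01 g by rewrite valuation_lt.
have low Y U i : (i < k)%N ->
    [eta [eta e with k |-> Y] with k.+1 |-> U] i = e i.
  by move=> ik; rewrite valuation_lt ?valuation_lt // ltnS ltnW.
have [_ e1 e2 _ e4] := eP.
have belowE Y U : let e'' := [eta [eta e with k |-> Y] with k.+1 |-> U] in
    holds (M := P) e'' (And (fbelow k.+1 x 2) (And (fbelow k.+1 k 1)
      (fbelow z k.+1 4))) <->
    below_sum U (code01 f) (endo_image s2) /\
    below_sum U Y (endo_image s1) /\
    below_sum (e z) U (endo_image (s1 - s2)).
  have kE : [eta [eta e with k |-> Y] with k.+1 |-> U] k = Y.
    by rewrite valuation_lt //= eqxx.
  have kSE : [eta [eta e with k |-> Y] with k.+1 |-> U] k.+1 = U.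
    by rewrite /= eqxx.
  move=> e''; rewrite /e'' -ex -e1 -e2 -e4.
  split=> [[/fbelowP + [/fbelowP + /fbelowP]]|[? [? ?]]].
    by rewrite kE kSE !low //; apply: leq_trans k4.
  split; [|split]; apply/fbelowP; rewrite ?kE ?kSE !low //; exact: leq_trans k4.
split=> [[/(fcodeP _ eP)[h ez] [Y [/(fcode02P _ (e'P Y) (e'y Y)) eY]]]|ez].
  rewrite /= eqxx in eY; rewrite ez eY.
  move=> [U /belowE]; rewrite ez => below.
  by congr (endo_image (_ - _ * _)); apply/(graph_add sP); exists U.
split; first by apply/(fcodeP _ eP); exists (f + g).
have [U Ubelow] := (graph_add sP f g (f + g)).2 erefl.
exists (code02 g); split.
  by apply/(fcode02P _ (e'P _) (e'y _)); rewrite /= eqxx.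
by exists U; apply/belowE; rewrite ez.
Qed.

Lemma fmulP e k x y z f g : frame_valuation e ->
    (x < k)%N -> (y < k)%N -> (z < k)%N -> (4 < k)%N ->
    e x = code01 f -> e y = code01 g ->
  holds (M := P) e (fmul k x y z) <-> e z = code01 (f * g).
Proof.
move=> eP xk yk zk k4 ex ey.
have e1P X := frame_valuation_upd X k4 eP.
have e1x X : [eta e with k |-> X] x = code01 f by rewrite valuation_lt.
have e2P X Y := frame_valuation_upd Y (leqW k4) (e1P X).
pose e2 X Y := [eta [eta e with k |-> X] with k.+1 |-> Y].
have e2k X Y : e2 X Y k = X by rewrite /e2 valuation_lt //= eqxx.
have e2k1 X Y : e2 X Y k.+1 = Y by rewrite /e2 /= eqxx.
pose e3 X Y Z := [eta (e2 X Y) with k.+2 |-> Z].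
have e3P X Y Z : frame_valuation (e3 X Y Z).
  exact: frame_valuation_upd (leqW (leqW k4)) (e2P X Y).
have e3low X Y Z i : (i < k)%N -> e3 X Y Z i = e i.
  move=> ik; rewrite /e3 valuation_lt; last exact: leqW (leqW ik).
  by rewrite /e2 valuation_lt ?valuation_lt // ltnS ltnW.
have e3k1 X Y Z : e3 X Y Z k.+1 = Y by rewrite /e3 valuation_lt.
have e3k2 X Y Z : e3 X Y Z k.+2 = Z by rewrite /e3 /= eqxx.
(* The order is reversed because in [f * g] the factor [g] acts first. *)
have mulP h := graph_mul sP g f h.
split=> [[/(fcodeP _ eP)[h ez] [X [/(fcode02P _ (e1P X) (e1x X)) eX]]]|ez].
  rewrite /= eqxx in eX; subst X.
  move=> [Y [/(fcode12P _ (e2P _ _) (e2k _ _))]].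
  rewrite -/(e2 _ _) e2k1 => ->.
  have e3z W Y' Z : e3 W Y' Z z = code01 h by rewrite e3low.
  move=> [Z [/(fcode02P _ (e3P _ _ _) (e3z _ _ _))]].
  rewrite -/(e2 _ _) -/(e3 _ _ _) e3k2 => -> /fbelowP.
  by rewrite e3k2 e3k1 e3low // ey ez => /mulP ->.
split; first by apply/(fcodeP _ eP); exists (f * g).
exists (code02 f); split.
  by apply/(fcode02P _ (e1P _) (e1x _)); rewrite /= eqxx.
exists (code12 f); split; first exact/(fcode12P _ (e2P _ _) (e2k _ _))/e2k1.
exists (code02 (f * g)); split.
  apply/(fcode02P _ (e3P _ _ _)); last exact: e3k2.
  by rewrite -ez; apply: e3low.
apply/fbelowP; rewrite -/(e2 _ _) -/(e3 _ _ _) e3k2 e3k1 e3low // ey.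
exact/mulP.
Qed.

End Codes.
End LatticeSemantics.

(** * Correctness of the translation *)

Section Translation.
Variables (R : pzRingType) (V : lmodType R) (s0 s1 s2 : endo V).
Hypothesis sP : is_frame s0 s1 s2.
Local Notation P := (submodule_lattice V).
Local Notation frame_valuation := (frame_valuation s0 s1 s2).
Local Notation code01 f := (endo_image (s0 - s1 * f)).
Implicit Types (e : nat -> submodule V) (d : nat -> endo V).

Definition codes e d (l : seq nat) :=
  forall n, n \in l -> e (ring_var n) = code01 (d n).

Lemma codes_catl e d l1 l2 : codes e d (l1 ++ l2) -> codes e d l1.
Proof. by move=> ed n nl; apply: ed; rewrite mem_cat nl. Qed.

Lemma codes_catr e d l1 l2 : codes e d (l1 ++ l2) -> codes e d l2.
Proof. by move=> ed n nl; apply: ed; rewrite mem_cat nl orbT. Qed.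

Lemma codes_upd e d l k X : (forall n, n \in l -> (ring_var n < k)%N) ->
  codes e d l -> codes [eta e with k |-> X] d l.
Proof. by move=> lk ed n nl; rewrite valuation_lt ?lk // ed. Qed.

Lemma ring_var_fresh z t n :
  n \in ring_term_vars t -> (ring_var n < fresh z t)%N.
Proof.
rewrite /fresh /ring_var; elim: (ring_term_vars t) => //= m l IH.
by rewrite inE => /orP[/eqP -> | /IH]; lia.
Qed.

Definition term_correct t := forall z e d,
  frame_valuation e -> codes e d (ring_term_vars t) ->
  holds (M := P) e (fterm t z) <-> e z = code01 (ring_eval (A := endo V) d t).

(** Sums and products are treated alike: the hypotheses on [u] and [v] force [k] and [k.+1] to hold
    the codes of their values. *)
Lemma fbinaryP (fop : nat -> nat -> nat -> nat -> formula inclusion_language)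
    (op : endo V -> endo V -> endo V) u v z k e d :
    (forall e k x y z f g, frame_valuation e ->
       (x < k)%N -> (y < k)%N -> (z < k)%N -> (4 < k)%N ->
       e x = code01 f -> e y = code01 g ->
       holds (M := P) e (fop k x y z) <-> e z = code01 (op f g)) ->
    term_correct u -> term_correct v -> (z < k)%N -> (4 < k)%N ->
    (forall n, n \in ring_term_vars u ++ ring_term_vars v ->
       (ring_var n < k)%N) ->
    frame_valuation e -> codes e d (ring_term_vars u ++ ring_term_vars v) ->
  holds (M := P) e (Exists k (Exists k.+1
    (And (fterm u k) (And (fterm v k.+1) (fop k.+2 k k.+1 z))))) <->
  e z = code01 (op (ring_eval (A := endo V) d u) (ring_eval (A := endo V) d v)).
Proof.
move=> fopP uP vP zk k4 uvk eP ed.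
pose e' X Y := [eta [eta e with k |-> X] with k.+1 |-> Y].
have e'P X Y : frame_valuation (e' X Y).
  exact: frame_valuation_upd (leqW k4) (frame_valuation_upd X k4 eP).
have e'd X Y : codes (e' X Y) d (ring_term_vars u ++ ring_term_vars v).
  by apply: codes_upd; [move=> n /uvk/leqW|apply: codes_upd].
have e'u X Y := codes_catl (e'd X Y); have e'v X Y := codes_catr (e'd X Y).
have e'z X Y : e' X Y z = e z by rewrite /e' valuation_lt ?valuation_lt // leqW.
have e'k X Y : e' X Y k = X by rewrite /e' valuation_lt //= eqxx.
have e'k1 X Y : e' X Y k.+1 = Y by rewrite /e' /= eqxx.
have opP X Y f g ek ek1 := fopP (e' X Y) k.+2 k k.+1 z f g (e'P X Y)
  (leqW (ltnSn k)) (ltnSn _) (leqW (leqW zk)) (leqW (leqW k4)) ek ek1.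
split=> [[X [Y [/(uP _ _ _ (e'P X Y) (e'u X Y)) eX]]]|ez].
  move=> [/(vP _ _ _ (e'P X Y) (e'v X Y)) eY /(opP _ _ _ _ eX eY)].
  by rewrite e'z.
set X := code01 (ring_eval (A := endo V) d u).
set Y := code01 (ring_eval (A := endo V) d v).
exists X, Y; split; first exact/(uP _ _ _ (e'P X Y) (e'u X Y))/e'k.
split; first exact/(vP _ _ _ (e'P X Y) (e'v X Y))/e'k1.
by apply/(opP _ _ _ _ (e'k X Y) (e'k1 X Y)); rewrite e'z.
Qed.

Lemma ftermP t : term_correct t.
Proof.
elim: t => [n|||u IHu|u IHu v IHv|u IHu v IHv] z e d eP ed.
- by rewrite -(ed n) ?inE.
- by have [e0 _ _ _ _] := eP; rewrite code01_0 -e0.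
- by have [_ _ _ e3 _] := eP; rewrite code01_1 -e3.
- set k := fresh z (Opp u).
  have zk : (z < k)%N by rewrite /k /fresh; lia.
  have k4 : (6 < k)%N by rewrite /k /fresh; lia.
  have e'P X := frame_valuation_upd X (ltnW (ltnW k4)) eP.
  have e'd X : codes [eta e with k |-> X] d (ring_term_vars u).
    by apply: codes_upd ed => n nu; apply: (@ring_var_fresh z (Opp u)).
  have e'z X : [eta e with k |-> X] z = e z by rewrite valuation_lt.
  have e'k X : [eta e with k |-> X] k = X by rewrite /= eqxx.
  (* Variable 0 denotes A0, the code of zero, so the addition formula says that the values of [u]
     and [z] sum to 0. *)
  have e'0 X : [eta e with k |-> X] 0%N = code01 0.
    by rewrite code01_0; have [] := e'P X.
  split=> [[/(fcodeP sP _ eP)[f ez] [X [/(IHu _ _ _ (e'P X) (e'd X)) eX]]]|ez].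
    have ez' : [eta e with k |-> X] z = code01 f by rewrite e'z.
    move=> /(faddP sP (e'P X) (ltnSn _) (leqW zk) _ _ eX ez').
    rewrite e'0 => /(_ _ _)/(code01_inj sP) /esym uf.
    have {}uf : ring_eval (A := endo V) d u + f = 0 by apply: uf; lia.
    by rewrite ez /=; congr (endo_image (_ - _ * _)); apply/eqP;
      rewrite -addr_eq0 addrC uf.
  split; first by apply/(fcodeP sP _ eP); eexists; exact: ez.
  set X := code01 (ring_eval (A := endo V) d u).
  exists X; split; first by apply/(IHu _ _ _ (e'P X) (e'd X))/e'k.
  have ez' := etrans (e'z X) ez.
  apply/(faddP sP (e'P X) (ltnSn _) (leqW zk) _ _ (e'k X) ez'); try lia.
  by rewrite e'0 /= subrr.
- apply: (fbinaryP (op := +%R) (faddP sP) IHu IHv) eP ed.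
  + by rewrite /fresh; lia.
  + by rewrite /fresh; lia.
  + by move=> n; apply: (@ring_var_fresh z (Add u v)).
- apply: (fbinaryP (op := *%R) (fmulP sP) IHu IHv) eP ed.
  + by rewrite /fresh; lia.
  + by rewrite /fresh; lia.
  + by move=> n; apply: (@ring_var_fresh z (Mul u v)).
Qed.

(** By [fcodeP] the relativised quantifiers range exactly over the codes of endomorphisms, and by
    [code01_inj] equal codes mean equal endomorphisms. *)
Lemma translateP f e d : frame_valuation e -> codes e d (free_vars f) ->
  holds (M := P) e (translate f) <-> holds (M := ring_structure (endo V)) d f.
Proof.
have quantified n (g : formula ring_language) e' d' (h : endo V) :
    codes e' d' (free_vars (Forall n g)) ->
    codes [eta e' with ring_var n |-> code01 h] [eta d' with n |-> h]
      (free_vars g).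
  move=> ed' m mg; rewrite /= /ring_var eqn_add2r; case: eqP => // /eqP mn.
  by apply: ed'; rewrite mem_filter mn.
elim: f e d =>
  [[t u]||g IHg|g IHg h IHh|g IHg h IHh|g IHg h IHh|n g IHg|n g IHg] e d eP ed.
- rewrite [translate _]/=; set k := (fresh 0 t + fresh 0 u)%N.
  have k4 : (4 < k)%N by rewrite /k /fresh; lia.
  have e'P X := frame_valuation_upd X k4 eP.
  have e'd X :
      codes [eta e with k |-> X] d (ring_term_vars t ++ ring_term_vars u).
    apply: codes_upd ed => n; rewrite mem_cat /k.
    by move=> /orP[] /(ring_var_fresh 0); lia.
  have tP X := ftermP k (e'P X) (codes_catl (e'd X)).
  have uP X := ftermP k (e'P X) (codes_catr (e'd X)).
  have e'k X : [eta e with k |-> X] k = X by rewrite /= eqxx.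
  split=> [[X [/tP + /uP]]|tu]; rewrite ?e'k.
    by move=> -> /(code01_inj sP).
  exists (code01 (ring_eval (A := endo V) d t)).
  by split; [apply/tP|apply/uP; rewrite -[in RHS]tu]; apply: e'k.
- by [].
- by rewrite /= (IHg _ _ eP ed).
- by rewrite /= (IHg _ _ eP (codes_catl ed)) (IHh _ _ eP (codes_catr ed)).
- by rewrite /= (IHg _ _ eP (codes_catl ed)) (IHh _ _ eP (codes_catr ed)).
- by rewrite /= (IHg _ _ eP (codes_catl ed)) (IHh _ _ eP (codes_catr ed)).
- have n4 : (4 < ring_var n)%N by rewrite /ring_var; lia.
  have e'P X := frame_valuation_upd X n4 eP.
  have IH h := IHg _ _ (e'P _) (quantified _ _ _ _ h ed).
  split=> [all h|all X].
    apply/IH/all; apply/(fcodeP sP _ (e'P _)).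
    by exists h; rewrite /= eqxx.
  move=> /(fcodeP sP _ (e'P X))[h]; rewrite /= eqxx => ->.
  exact/IH/all.
- have n4 : (4 < ring_var n)%N by rewrite /ring_var; lia.
  have e'P X := frame_valuation_upd X n4 eP.
  have IH h := IHg _ _ (e'P _) (quantified _ _ _ _ h ed).
  split=> [[X []]|[h gh]].
    by move=> /(fcodeP sP _ (e'P X))[h]; rewrite /= eqxx => -> /IH; exists h.
  exists (code01 h); split; last exact/IH.
  by apply/(fcodeP sP _ (e'P _)); exists h; rewrite /= eqxx.
Qed.

End Translation.

(** * Closing off the parameters *)

(** The translation has the frame parameters free, whereas elementary equivalence compares
    sentences. *)
Definition universal_closure (L : language) (f : formula L) : formula L :=
  foldr (@Forall L) f (free_vars f).

Lemma sentence_universal_closure (L : language) (f : formula L) :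
  sentence (universal_closure f).
Proof.
rewrite /sentence /universal_closure.
have -> l : free_vars (foldr (@Forall L) f l) =
    [seq n <- free_vars f | n \notin l].
  elim: l => [|m l IH] /=; first by rewrite filter_predT.
  rewrite IH -filter_predI; apply: eq_filter => n /=.
  by rewrite inE negb_or.
by rewrite -(filter_pred0 (free_vars f)); apply: eq_in_filter => n /= ->.
Qed.

Lemma models_universal_closure (L : language) (M : structure L)
    (f : formula L) :
  models M (universal_closure f) <-> models M f.
Proof.
rewrite /universal_closure; elim: (free_vars f) => //= n l <-.
split=> [all e|all e x]; last exact: all.
have updE : (fun m => [eta e with n |-> e n] m) = e.
  by apply/funext => m /=; case: eqP => // ->.
by rewrite -updE; exact: all.
Qed.

(** Every valuation satisfying [fframe] interprets the same ring, which gives one direction; for the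
    other, infinite rank provides such a valuation, so that the implication is not vacuous. *)
Lemma models_endo_ring (R : pzRingType) (V : lmodType R)
    (f : formula ring_language) :
  free_of_infinite_rank V -> sentence f ->
  models (ring_structure (endo V)) f <->
  models (submodule_lattice V) (Imp fframe (translate f)).
Proof.
move=> /fframe_satisfiable[e0 e0P] closed_f.
have codes0 (s0 s1 : endo V) e d : codes s0 s1 e d (free_vars f).
  by rewrite closed_f.
split=> [fV e /fframe_sound[s0 [s1 [s2 [sP eP]]]]|fP d].
  exact/(translateP sP eP (codes0 _ _ _ (fun=> 0)))/fV.
have [s0 [s1 [s2 [sP eP]]]] := fframe_sound e0P.
exact/(translateP sP eP (codes0 _ _ _ d))/fP.
Qed.

Theorem theorem12 (R1 R2 : pzRingType) (V1 : lmodType R1) (V2 : lmodType R2) :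
  free_of_infinite_rank V1 -> free_of_infinite_rank V2 ->
  elementarily_equivalent (submodule_lattice V1) (submodule_lattice V2) ->
  elementarily_equivalent (ring_structure (endo V1)) (ring_structure (endo V2)).
Proof.
move=> V1inf V2inf V12 f closed_f.
rewrite (models_endo_ring V1inf closed_f) (models_endo_ring V2inf closed_f).
rewrite -(models_universal_closure (submodule_lattice V1)).
rewrite -(models_universal_closure (submodule_lattice V2)).
exact/V12/sentence_universal_closure.
Qed.
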